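(* Let $k\geq 3$ and let $n_1\leq n_2\leq\cdots\leq n_k$ be positive integers. Then $$\sigma_T(K_{n_1,n_2,\ldots,n_k})=\begin{cases} 2,& \text{if } n_1=1,\\ 3,& \text{otherwise}.\end{cases}$$
   Context: All graphs are finite and simple. For a connected graph $G$ (with at least one edge) and a spanning tree $T$ of $G$, let $d_T(u,v)$ be the distance between $u$ and $v$ in $T$. The stretch of $T$ is $\sigma_T(G,T):=\max_{uv\in E(G)} d_T(u,v)$, and the tree-stretch of $G$ is $\sigma_T(G):=\min\{\sigma_T(G,T): T \text{ is a spanning tree of } G\}$ (the subscript $T$ in $\sigma_T(G)$ is part of the notation and does not refer to a particular tree). The complete $k$-partite graph $K_{n_1,\ldots,n_k}$ has vertex set partitioned into $V_1,\ldots,V_k$ with $|V_i|=n_i$, and two vertices are adjacent if and only if they lie in different parts. *)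

(* Defs.v *)
From HB Require Import structures.
From mathcomp Require Import all_boot.

Set Implicit Arguments.
Unset Strict Implicit.
Unset Printing Implicit Defensive.

(* A simple graph on V is its set of edges, an edge being a 2-element subset
   of V. For a fixed V these graphs form a finite type, so that one can
   minimise over spanning trees. *)
Record sgraph (V : finType) := SGraph {
  edges : {set {set V}};
  _ : [forall A in edges, #|A| == 2] }.

HB.instance Definition _ (V : finType) := [isSub for @edges V].
HB.instance Definition _ (V : finType) := [Finite of sgraph V by <:].

Definition adj (V : finType) (G : sgraph V) : rel V :=
  [rel u v | [set u; v] \in edges G].

Definition connected_graph (V : finType) (G : sgraph V) : bool :=
  (0 < #|V|) && [forall u, forall v, connect (adj G) u v].

(* A cycle is a cyclic sequence of at least 3 distinct vertices; without the
   bound, every edge u v would give the cycle [:: u; v]. *)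
Definition acyclic_graph (V : finType) (G : sgraph V) : bool :=
  [forall m : 'I_#|V|.+1, forall c : m.-tuple V,
     ~~ [&& 3 <= m, uniq c & cycle (adj G) c]].

Definition spanning_tree (V : finType) (G T : sgraph V) : bool :=
  [&& edges T \subset edges G, connected_graph T & acyclic_graph T].

Definition has_path_of_length (V : finType) (G : sgraph V) (u v : V)
    (m : nat) : bool :=
  [exists p : m.-tuple V,
     [&& path (adj G) u p, uniq (u :: p) & last u p == v]].

(* The least length of a path from u to v. A path has fewer than #|V| edges,
   so the value #|V| is taken only when there is no path. *)
Definition dist (V : finType) (G : sgraph V) (u v : V) : nat :=
  \big[minn/#|V|]_(m < #|V| | has_path_of_length G u v m) m.

Definition stretch (V : finType) (G T : sgraph V) : nat :=
  \max_(p : V * V | adj G p.1 p.2) dist T p.1 p.2.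

(* No stretch exceeds #|V|, so the neutral element #|V| does not affect the
   minimum when G has a spanning tree: see tree_stretch_min. *)
Definition tree_stretch (V : finType) (G : sgraph V) : nat :=
  \big[minn/#|V|]_(T : sgraph V | spanning_tree G T) stretch G T.

Lemma bigmin_min (I : finType) (P : pred I) (F : I -> nat) (b : nat) (i : I) :
  P i -> \big[minn/b]_(j | P j) F j <= F i.
Proof.
move=> Pi; have : i \in index_enum I by rewrite mem_index_enum.
elim: (index_enum I) => [//|j r IHr]; rewrite inE big_cons.
case/orP => [/eqP <-|/IHr le_r]; first by rewrite Pi geq_minl.
by case: ifP => // _; rewrite geq_min le_r orbT.
Qed.

Lemma bigmin_attained (I : finType) (P : pred I) (F : I -> nat) (b : nat) :
    (exists i, P i) -> (forall i, P i -> F i <= b) ->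
  exists2 i, P i & \big[minn/b]_(j | P j) F j = F i.
Proof.
case=> i0 Pi0 leFb.
have [eq_b|//] : \big[minn/b]_(j | P j) F j = b \/
    exists2 i, P i & \big[minn/b]_(j | P j) F j = F i.
  elim/big_rec: _ => [|i x Pi [->|[j Pj ->]]]; first by left.
    by right; exists i => //; apply/minn_idPl/leFb.
  by right; rewrite minnC /minn; case: ifP => _; [exists j | exists i].
exists i0 => //; apply/eqP; rewrite eqn_leq bigmin_min //=.
by rewrite eq_b leFb.
Qed.

Lemma dist_attained (V : finType) (G : sgraph V) (u v : V) :
    (exists m : 'I_#|V|, has_path_of_length G u v m) ->
  has_path_of_length G u v (dist G u v).
Proof.
move=> ex; rewrite /dist.
have [|m Pm ->//] := bigmin_attained (F := @nat_of_ord _) (b := #|V|) ex.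
by move=> m _; apply: ltnW.
Qed.

Lemma stretch_le (V : finType) (G T : sgraph V) : stretch G T <= #|V|.
Proof.
apply/bigmax_leqP => p _; rewrite /dist.
by elim/big_rec: _ => [//|m x _ le_x]; rewrite geq_min le_x orbT.
Qed.

Lemma tree_stretch_min (V : finType) (G : sgraph V) :
    (exists T, spanning_tree G T) ->
  (exists2 T, spanning_tree G T & tree_stretch G = stretch G T) /\
  (forall T, spanning_tree G T -> tree_stretch G <= stretch G T).
Proof.
move=> ex; split; last by move=> T; apply: bigmin_min.
by apply: bigmin_attained => // T _; apply: stretch_le.
Qed.

(* The i-th part of the vertex set consists of the pairs with first
   component i, and has n i elements. *)
Definition multipartite_vertex (k : nat) (n : 'I_k -> nat) : finType :=
  {i : 'I_k & 'I_(n i)}.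

Definition multipartite_edges (k : nat) (n : 'I_k -> nat) :
    {set {set multipartite_vertex n}} :=
  [set [set p.1; p.2] | p : multipartite_vertex n * multipartite_vertex n
                      & tag p.1 != tag p.2].

Lemma multipartite_edges_card2 (k : nat) (n : 'I_k -> nat) :
  [forall A in multipartite_edges n, #|A| == 2].
Proof.
apply/forall_inP => A /imsetP[[u v]]; rewrite inE /= => neq_tag ->.
have neq_uv : u != v.
  by apply/eqP => eq_uv; rewrite eq_uv eqxx in neq_tag.
by rewrite cards2 neq_uv.
Qed.

Definition complete_multipartite (k : nat) (n : 'I_k -> nat) :
    sgraph (multipartite_vertex n) :=
  SGraph (multipartite_edges_card2 n).

Lemma adj_complete_multipartite (k : nat) (n : 'I_k -> nat)
    (u v : multipartite_vertex n) :
  adj (complete_multipartite n) u v = (tag u != tag v).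
Proof.
apply/imsetP/idP => [[[x y]]|neq]; last by exists (u, v); rewrite ?inE.
rewrite inE /= => neq_xy eq_uv.
have /orP[/eqP eu|/eqP eu] : (u == x) || (u == y)
  by rewrite -in_set2 -eq_uv set21.
all: have /orP[/eqP ev|/eqP ev] : (v == x) || (v == y)
  by rewrite -in_set2 -eq_uv set22.
all: subst u v; rewrite // 1?eq_sym //.
  have : y \in [set x; x] by rewrite eq_uv set22.
  by rewrite !inE orbb => /eqP eq_yx; rewrite eq_yx eqxx in neq_xy.
have : x \in [set y; y] by rewrite eq_uv set21.
by rewrite !inE orbb => /eqP eq_xy; rewrite eq_xy eqxx in neq_xy.
Qed.

(* Main.v *)
Require Import Defs.
From mathcomp Require Import all_boot.

(** The upper bounds come from one double star. Take [u] in the smallest part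
    and [v] in another part; join each vertex of the part of [u] to [v], and
    every other vertex to [u]. Each edge of this tree has an end in {u, v}, so
    any two vertices are at distance at most 3, and two vertices outside the
    part of [u] are at distance at most 2, through [u]. If [u] is alone in its
    part, the tree is a star with centre [u], so its stretch is at most 2.

    The stretch is at least 2 since three vertices in distinct parts form a
    triangle, which a tree cannot contain.

    Suppose finally that a spanning tree [T] has stretch at most 2. Everything
    rests on [acyclic_no_detour]: in an acyclic graph, two neighbours of [b]
    cannot be joined by a walk that avoids [b]. If [b] has neighbours [c] and
    [w] in [T] that lie in distinct parts, then [b] is alone in its part
    ([branching_vertex_alone]): another vertex [b'] of this part would be
    adjacent to both [c] and [w] in the multipartite graph, hence within two
    steps of each in [T], and these steps avoid [b] because [b] and [b'] are
    not adjacent. Such a [b] exists ([branching_vertex_exists]): for an edge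
    [bc] of [T] and a vertex [w] in a third part, [w] is within two steps of
    both [b] and [c], so, there being no short cycle, it is adjacent in [T] to
    one of them. Hence some part is a singleton, and so is the smallest one. *)

Set Implicit Arguments.
Unset Strict Implicit.
Unset Printing Implicit Defensive.

(** * Walks, distances and cycles in a finite graph *)

Section Graphs.

Variables (V : finType) (G : sgraph V).
Implicit Types (u v x y b c w : V).

Lemma adj_sym : symmetric (adj G).
Proof. by move=> x y; rewrite /adj /= setUC. Qed.

Lemma dist_le_walk u p : path (adj G) u p -> dist G u (last u p) <= size p.
Proof.
(* Distances are measured by simple paths only, so the walk is shortened. *)
move=> up; have [q uq uniq_q sub_qp] := shortenP up.
have le_qp : size q <= size p.
  by apply: uniq_leq_size => //; case/andP: uniq_q.
have lt_q : size q < #|V|.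
  by rewrite -[(size q).+1]/(size (u :: q)) -(card_uniqP uniq_q) max_card.
apply: leq_trans le_qp.
apply: (bigmin_min (@nat_of_ord _) #|V| (i := Ordinal lt_q)).
by apply/existsP; exists (in_tuple q); rewrite uq uniq_q eqxx.
Qed.

Lemma dist_le_path u v d : d < #|V| -> dist G u v <= d ->
  exists p, [/\ path (adj G) u p, last u p = v & size p <= d].
Proof.
move=> lt_d le_d; move: (le_d); rewrite /dist.
elim/big_rec: _ => [|m x Pm IHx]; first by rewrite leqNgt lt_d.
rewrite geq_min => /orP[le_md|/IHx//].
case/existsP: Pm => p /and3P[up _ /eqP lp].
by exists p; split; rewrite ?size_tuple.
Qed.

Lemma dist_le1_adj u v : 1 < #|V| -> u != v -> dist G u v <= 1 -> adj G u v.
Proof.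
move=> ltV neq_uv /(dist_le_path ltV)[[|x [|y p]]] [//= up lp _].
  by rewrite lp eqxx in neq_uv.
by rewrite -lp; case/andP: up.
Qed.

Lemma dist_le2_steps u v : 2 < #|V| -> u != v -> dist G u v <= 2 ->
  adj G u v \/ exists2 x, adj G u x & adj G x v.
Proof.
move=> ltV neq_uv /(dist_le_path ltV)[[|x [|y [|z p]]]] [//= up lp _].
- by rewrite lp eqxx in neq_uv.
- by left; rewrite -lp; case/andP: up.
- by right; exists x; rewrite -?lp; case/and3P: up.
Qed.

Lemma acyclic_graphP :
  reflect (forall c : seq V, 2 < size c -> uniq c -> ~~ cycle (adj G) c)
          (acyclic_graph G).
Proof.
apply: (iffP forallP) => [acG c ge3 uniq_c | acG m].
  have le_c : size c < #|V|.+1 by rewrite ltnS -(card_uniqP uniq_c) max_card.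
  move/forallP: (acG (Ordinal le_c)) => /(_ (in_tuple c)).
  by rewrite /= ge3 uniq_c.
apply/forallP => c; apply/and3P => -[ge3 uniq_c cyc].
by move: cyc; apply/negP/acG; rewrite ?size_tuple.
Qed.

Definition adj_avoiding b : rel V :=
  [rel x y | [&& adj G x y, x != b & y != b]].

Lemma connect_avoiding_sym b : connect_sym (adj_avoiding b).
Proof.
apply: sym_connect_sym => x y; rewrite /adj_avoiding /=.
by rewrite adj_sym; congr (_ && _); rewrite andbC.
Qed.

(** A walk from [c] to [w] avoiding [b] contains a simple path, which [b]
    closes into a cycle; [c != w] makes this cycle have at least three
    vertices. *)
Lemma acyclic_no_detour b c w : acyclic_graph G ->
  adj G b c -> adj G b w -> c != b -> c != w ->
  ~~ connect (adj_avoiding b) c w.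
Proof.
move=> /acyclic_graphP acG bc bw neq_cb neq_cw; apply/negP => /connectP[p0 cp0].
have [p cp uniq_p _] := shortenP cp0 => def_w.
have b_notin : b \notin c :: p.
  rewrite inE negb_or eq_sym neq_cb /=.
  elim: p c cp {cp0 bc neq_cb neq_cw uniq_p def_w} => //= x p IHp c.
  case/andP=> /and3P[_ _ neq_xb] /IHp b_notin.
  by rewrite inE negb_or eq_sym neq_xb.
have path_p : path (adj G) c p.
  by apply: sub_path cp => x y /and3P[].
have /negP[] : ~~ cycle (adj G) (b :: c :: p).
  apply: acG; last by rewrite cons_uniq b_notin.
  case: p def_w {cp uniq_p b_notin path_p} => //= eq_wc.
  by rewrite eq_wc eqxx in neq_cw.
by rewrite /= bc rcons_path path_p -def_w adj_sym.
Qed.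

(** On a cycle every vertex has two distinct neighbours, and a cycle is too
    long to consist of the two hubs alone. *)
Lemma acyclic_of_two_hubs u v (f : V -> V) :
  (forall x y, x != u -> x != v -> adj G x y -> y = f x) -> acyclic_graph G.
Proof.
move=> leaf; apply/acyclic_graphP => c ge3 uniq_c; apply/negP => cyc.
have /allPn[x xc] : ~~ all (mem [:: u; v]) c.
  apply/negP => /allP sub; have := uniq_leq_size uniq_c sub.
  by rewrite leqNgt ge3.
rewrite !inE negb_or => /andP[neq_xu neq_xv].
have [i s def_s] := rot_to xc.
move: ge3 uniq_c cyc; rewrite -(size_rot i) -(rot_uniq i) -(rot_cycle i) def_s.
case: s {def_s} => [|y [|z s]] //= _ /and3P[_ y_notin _].
rewrite rcons_path => /and4P[xy _ _ last_x].
rewrite adj_sym in last_x.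
rewrite (leaf x y) // -(leaf x (last z s)) // in y_notin.
by rewrite mem_last in y_notin.
Qed.

Lemma dist_le_stretch (T : sgraph V) x y : adj G x y ->
  dist T x y <= stretch G T.
Proof.
by move=> xy; apply: (@leq_bigmax_cond _ _ (fun p => dist T p.1 p.2) (x, y)).
Qed.

Lemma adj_subgraph (T : sgraph V) x y :
  edges T \subset edges G -> adj T x y -> adj G x y.
Proof. by move=> /subsetP sTG; apply: sTG. Qed.

End Graphs.

Section Multipartite.

Variables (k : nat) (n : 'I_k -> nat).
Hypotheses (hk : 3 <= k) (npos : forall i : 'I_k, 0 < n i).

Local Notation V := (multipartite_vertex n).
Local Notation K := (complete_multipartite n).

Implicit Types (u v x y b c w : V) (T : sgraph V).

Definition part_vertex (i : 'I_k) : V :=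
  Tagged (fun i => 'I_(n i)) (Ordinal (npos i)).

Lemma third_part (i j : 'I_k) : exists w, (tag w != i) && (tag w != j).
Proof.
have /subsetPn[l _] : ~~ ([set: 'I_k] \subset [set i; j]).
  apply/negP => /subset_leq_card; rewrite cardsT card_ord cards2 => le_k.
  by have := leq_trans hk le_k; case: (i != j).
by rewrite !inE negb_or => l_ij; exists (part_vertex l).
Qed.

Lemma multipartite_card : 2 < #|{: V}|.
Proof.
apply: leq_trans hk _; rewrite -[k in k <= _]card_ord.
by apply: (leq_card part_vertex) => i j /(congr1 tag).
Qed.

(** * The double star *)

Section DoubleStar.

Variables (u v : V).
Hypothesis neq_uv : tag u != tag v.

(** The edges of the double star are the pairs {x, hub x}. The hubs are sent to
    each other, so no vertex needs an exception: the central edge just arises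
    twice. *)
Definition hub x : V := if tag x == tag u then v else u.

Lemma hub_tag x : tag (hub x) != tag x.
Proof.
by rewrite /hub; case: (tag x =P tag u) => [->|/eqP]; rewrite eq_sym.
Qed.

Lemma hub_u : hub u = v. Proof. by rewrite /hub eqxx. Qed.

Lemma hub_v : hub v = u.
Proof. by rewrite /hub eq_sym (negPf neq_uv). Qed.

Definition double_star_edges : {set {set V}} :=
  [set [set x; hub x] | x in [set: V]].

Lemma double_star_edges_card2 : [forall A in double_star_edges, #|A| == 2].
Proof.
apply/forall_inP => A /imsetP[x _ ->].
by rewrite cards2; have := hub_tag x; case: (x =P hub x) => // <-; rewrite eqxx.
Qed.

Definition double_star : sgraph V := SGraph double_star_edges_card2.

Lemma adj_hub x : adj double_star x (hub x).
Proof. by apply/imsetP; exists x. Qed.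

Lemma adj_to_hub x : adj double_star (hub x) x.
Proof. by rewrite adj_sym adj_hub. Qed.

Lemma adj_double_star x y : adj double_star x y -> y = hub x \/ x = hub y.
Proof.
case/imsetP => z _ eq_xy.
have /set2P ex : x \in [set z; hub z] by rewrite -eq_xy set21.
have /set2P ey : y \in [set z; hub z] by rewrite -eq_xy set22.
have ez : z \in [set x; y] by rewrite eq_xy set21.
have eh : hub z \in [set x; y] by rewrite eq_xy set22.
case: ex ey => ex [] ey; rewrite ex ey in ez eh *; auto; exfalso.
- by move: eh (hub_tag z); rewrite !inE orbb => /eqP ->; rewrite eqxx.
- by move: ez (hub_tag z); rewrite !inE orbb => /eqP <-; rewrite eqxx.
Qed.

Lemma double_star_spanning : spanning_tree K double_star.
Proof.
apply/and3P; split.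
- apply/subsetP => A /imsetP[x _ ->].
  by have := adj_complete_multipartite x (hub x); rewrite eq_sym hub_tag.
- apply/andP; split; first by apply/card_gt0P; exists u.
  have con_u x : connect (adj double_star) x u.
    apply: connect_trans (connect1 (adj_hub x)) _.
    rewrite {1}/hub; case: ifP => _; last exact: connect0.
    by apply: connect1; have := adj_hub v; rewrite hub_v.
  apply/forallP => x; apply/forallP => y; apply: connect_trans (con_u x) _.
  by rewrite (sym_connect_sym (@adj_sym _ double_star)).
- apply: (@acyclic_of_two_hubs _ _ u v hub) => x y xu xv.
  case/adj_double_star => // eq_x; move: xu xv; rewrite eq_x /hub.
  by case: ifP; rewrite eqxx.
Qed.

Lemma double_star_stretch : stretch K double_star <= 3.
Proof.
apply/bigmax_leqP => -[x y] /= _.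
have [eq_h|neq_h] := eqVneq (hub x) (hub y).
  apply: (@leq_trans 2) => //.
  apply: (@dist_le_walk _ double_star x [:: hub x; y]).
  by rewrite /= adj_hub eq_h adj_to_hub.
apply: (@dist_le_walk _ double_star x [:: hub x; hub y; y]).
rewrite /= adj_hub adj_to_hub /= andbT.
have [[-> ->]|[-> ->]] : hub x = u /\ hub y = v \/ hub x = v /\ hub y = u.
  by move: neq_h; rewrite /hub; do 2 case: ifP; rewrite ?eqxx; auto.
- by have := adj_hub u; rewrite hub_u.
- by have := adj_hub v; rewrite hub_v.
Qed.

Lemma star_stretch : (forall x, tag x = tag u -> x = u) ->
  stretch K double_star <= 2.
Proof.
move=> u_alone; apply/bigmax_leqP => -[x y] /=.
rewrite adj_complete_multipartite => neq_xy.
have u_adj z : tag z != tag u -> adj double_star z u.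
  by move=> zu; have := adj_hub z; rewrite {1}/hub (negPf zu).
have [/u_alone eq_x|xu] := eqVneq (tag x) (tag u).
  apply: (@leq_trans 1) => //; apply: (@dist_le_walk _ double_star x [:: y]).
  by rewrite /= andbT adj_sym eq_x u_adj // -eq_x eq_sym.
have [/u_alone eq_y|yu] := eqVneq (tag y) (tag u).
  apply: (@leq_trans 1) => //; apply: (@dist_le_walk _ double_star x [:: y]).
  by rewrite /= andbT eq_y u_adj.
apply: (@dist_le_walk _ double_star x [:: u; y]).
by rewrite /= u_adj //= adj_sym u_adj.
Qed.

End DoubleStar.

(** * Lower bounds *)

(** Stretch at most 1 would put every edge into the tree, including those of a
    triangle. *)
Lemma stretch_ge2 T : spanning_tree K T -> 1 < stretch K T.
Proof.
case/and3P=> _ _ /acyclic_graphP acT; rewrite ltnNge; apply/negP => le1.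
have [x _] := third_part (Ordinal hk) (Ordinal hk).
have [y /andP[yx _]] := third_part (tag x) (tag x).
have [z /andP[zx zy]] := third_part (tag x) (tag y).
have adjT a b : tag a != tag b -> adj T a b.
  move=> neq_ab; apply: dist_le1_adj.
  - exact: ltnW multipartite_card.
  - by apply: contra neq_ab => /eqP ->.
  - by apply: leq_trans le1; rewrite dist_le_stretch ?adj_complete_multipartite.
have neqV a b : tag a != tag b -> a != b by apply: contra => /eqP ->.
have /negP[] : ~~ cycle (adj T) [:: x; y; z].
  by apply: acT; rewrite //= !inE !negb_or !neqV // eq_sym.
by rewrite /= !adjT // eq_sym.
Qed.

Section StretchAtMost2.

Variable T : sgraph V.
Hypotheses (spT : spanning_tree K T) (le2 : stretch K T <= 2).

Let sTK : edges T \subset edges K. Proof. by case/and3P: spT. Qed.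
Let acT : acyclic_graph T. Proof. by case/and3P: spT. Qed.

Lemma tree_edge_tags x y : adj T x y -> tag x != tag y.
Proof. by move/(adj_subgraph sTK); rewrite adj_complete_multipartite. Qed.

Lemma tree_edge_neq x y : adj T x y -> x != y.
Proof. by move/tree_edge_tags; apply: contra => /eqP ->. Qed.

Lemma two_steps x y : tag x != tag y ->
  adj T x y \/ exists2 z, adj T x z & adj T z y.
Proof.
move=> neq_xy; apply: dist_le2_steps; first exact: multipartite_card.
  by apply: contra neq_xy => /eqP ->.
by apply: leq_trans le2; rewrite dist_le_stretch ?adj_complete_multipartite.
Qed.

(** A second vertex [b'] of the part of [b] would link [c] to [w] by a walk
    through [b'], of at most four edges, that avoids [b]. *)
Lemma branching_vertex_alone b c w :
  adj T b c -> adj T b w -> tag c != tag w ->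
  forall b', tag b' = tag b -> b' = b.
Proof.
move=> bc bw neq_cw b' tag_b'; apply/eqP/negPn/negP => neq_b'.
have con_b' x : adj T b x -> connect (adj_avoiding T b) x b'.
  move=> bx; have := tree_edge_neq bx; rewrite eq_sym => xb.
  have [xb'|[z xz zb']] : adj T x b' \/ exists2 z, adj T x z & adj T z b'.
  - by apply: two_steps; rewrite tag_b' eq_sym tree_edge_tags.
  - by apply: connect1; rewrite /adj_avoiding /= xb' xb neq_b'.
  have zb : z != b.
    by apply: contra (tree_edge_tags zb') => /eqP ->; rewrite tag_b'.
  apply: (@connect_trans _ _ z); apply: connect1.
  - by rewrite /adj_avoiding /= xz xb zb.
  - by rewrite /adj_avoiding /= zb' zb neq_b'.
have /negP[] : ~~ connect (adj_avoiding T b) c w.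
  apply: acyclic_no_detour => //; first by rewrite eq_sym tree_edge_neq.
  by apply: contra neq_cw => /eqP ->.
apply: connect_trans (con_b' c bc) _.
by rewrite connect_avoiding_sym con_b'.
Qed.

(** A vertex [w] of a third part that is adjacent in [T] to neither end of an
    edge [bc], yet within two steps of both, would close a cycle through [bc].
    This is where a third part is needed: a double star in a complete bipartite
    graph has no vertex with neighbours in two parts. *)
Lemma branching_vertex_exists :
  exists b c w, [/\ adj T b c, adj T b w & tag c != tag w].
Proof.
have [b [c bc]] : exists b c, adj T b c.
  have [x _] := third_part (Ordinal hk) (Ordinal hk).
  have [y /andP[yx _]] := third_part (tag x) (tag x).
  by have [yx'|[z yz _]] := two_steps yx; [exists y, x | exists y, z].
have [w /andP[wb wc]] := third_part (tag b) (tag c).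
case: (boolP (adj T b w)) => [bw|not_bw].
  by exists b, c, w; split; rewrite // eq_sym.
case: (boolP (adj T c w)) => [cw|not_cw].
  by exists c, b, w; split=> //; [rewrite adj_sym | rewrite eq_sym].
exfalso.
have [wb'|[x wx xb]] := two_steps wb; first by rewrite adj_sym wb' in not_bw.
have [wc'|[y wy yc]] := two_steps wc; first by rewrite adj_sym wc' in not_cw.
have neq_xb := tree_edge_neq xb.
have neq_wb : w != b by apply: contra wb => /eqP ->.
have neq_cb : c != b by rewrite eq_sym tree_edge_neq.
have neq_yb : y != b by apply: contra not_bw => /eqP <-; rewrite adj_sym.
have neq_xc : x != c by apply: contra not_cw => /eqP <-; rewrite adj_sym.
(* The walk x, w, y, c joins two neighbours of b and avoids b. *)
have bx : adj T b x by rewrite adj_sym.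
have /negP[] := acyclic_no_detour acT bx bc neq_xb neq_xc.
apply: (@connect_trans _ _ w).
  by apply: connect1; rewrite /adj_avoiding /= adj_sym wx neq_xb neq_wb.
apply: (@connect_trans _ _ y); apply: connect1.
  by rewrite /adj_avoiding /= wy neq_wb neq_yb.
by rewrite /adj_avoiding /= yc neq_yb neq_cb.
Qed.

Lemma singleton_part : exists i, n i = 1.
Proof.
have [b [c [w [bc bw cw]]]] := branching_vertex_exists.
have alone := branching_vertex_alone bc bw cw.
exists (tag b); apply/eqP; rewrite eqn_leq npos andbT leqNgt; apply/negP => lt1.
have eq_b (l : 'I_(n (tag b))) : l = tagged b.
  have /eqP := alone (Tagged (fun i => 'I_(n i)) l) erefl.
  by case: (b) l => i j l /=; rewrite eq_Tagged => /eqP.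
have eq_01 := etrans (eq_b (Ordinal lt1)) (esym (eq_b (Ordinal (npos _)))).
by have := congr1 val eq_01.
Qed.

End StretchAtMost2.

End Multipartite.

Theorem theorem3p1 (k : nat) (n : 'I_k -> nat) (hk : 3 <= k)
    (npos : forall i : 'I_k, 0 < n i)
    (nmono : forall i j : 'I_k, i <= j -> n i <= n j) :
  tree_stretch (complete_multipartite n) =
    if n (Ordinal (ltnW (ltnW hk))) == 1 then 2 else 3.
Proof.
set i0 := Ordinal _; pose u := part_vertex npos i0.
have [v /andP[]] := third_part hk npos i0 i0; rewrite eq_sym => neq_i0v _.
have neq_uv : tag u != tag v by [].
have spS := double_star_spanning neq_uv.
have [|[T spT eqT] min] := @tree_stretch_min _ (complete_multipartite n).
  by exists (double_star neq_uv).
case: ifP => [/eqP n1 | n_neq1]; apply/eqP; rewrite eqn_leq.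
  rewrite {2}eqT (stretch_ge2 hk npos spT) andbT.
  apply: leq_trans (min _ spS) _; apply: star_stretch => -[i l] /= eq_i.
  subst i; apply/eqP; rewrite /u /part_vertex eq_Tagged /= -val_eqE /=.
  by rewrite -leqn0 -ltnS -[X in _ < X]n1.
rewrite (leq_trans (min _ spS) (double_star_stretch neq_uv)) /= eqT ltnNge.
apply/negP => le2; have [i ni] := singleton_part hk npos spT le2.
have := nmono i0 i (leq0n i).
by rewrite ni leq_eqVlt n_neq1 ltnS leqNgt npos.
Qed.
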